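(* Let $C>0$ be a constant and consider the Riemannian surface $(\mathbb{R}^2,g_C)$, where $g_C=C(\cosh u)^6(du^2+dv^2)$ in the standard coordinates $(u,v)$ of $\mathbb{R}^2$. Then: (a) the metric $g_C$ on $\mathbb{R}^2$ is complete; (b) the Gaussian curvature $K_C$ of $g_C$ satisfies $K_C(u,v)=K_C(u)=-\dfrac{3}{C(\cosh u)^8}<0$ and $K_C'(u)=\dfrac{24}{C}\dfrac{\sinh u}{(\cosh u)^9}$, and therefore $\operatorname{grad}K_C\neq 0$ at any point of $\mathbb{R}^2\setminus Ov$, where $Ov=\{(0,v): v\in\mathbb{R}\}$; (c) the immersion $X_C:(\mathbb{R}^2,g_C)\to\mathbb{R}^3$ given by $$X_C(u,v)=\left(\sigma_C^1(u)\cos 3v,\ \sigma_C^1(u)\sin 3v,\ \sigma_C^2(u)\right)$$ is a biconservative immersion in $\mathbb{R}^3$, where $$\sigma_C^1(u)=\frac{C^{1/2}}{3}(\cosh u)^3,\qquad \sigma_C^2(u)=\frac{C^{1/2}}{2}\left(\frac12\sinh 2u+u\right),\qquad u\in\mathbb{R}.$$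
   Context: $\mathbb{R}^3$ carries its Euclidean metric. Immersions of Riemannian surfaces are Riemannian (i.e. isometric) immersions. For a Riemannian immersion $\phi:(M^2,g)\to N^3(c)$ into a 3-dimensional space form of constant sectional curvature $c$, let $\eta$ be a (local) unit normal field, $A$ the shape operator with respect to $\eta$, and $f=\operatorname{trace}A$ the mean curvature function. The immersion is called biconservative if $\operatorname{div}S_2=0$, where $S_2$ is the stress-bienergy tensor (equivalently, the tangent part of the bitension field of $\phi$ vanishes); for a surface in a 3-dimensional space form this is equivalent to $$A(\operatorname{grad}f)=-\frac{f}{2}\operatorname{grad}f .$$ *)

(* Defs.v *)
From Stdlib Require Import Reals Lra FunctionalExtensionality.
From Coquelicot Require Import Coquelicot.
Open Scope R_scope.

Definition plane : Type := (R * R)%type.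

(* Coordinate directions; a tangent vector is the function [dir -> R] of its
   components in the frame d/du, d/dv. *)
Inductive dir : Type := iu | iv.

Definition vec : Type := dir -> R.
Definition vec0 : vec := fun _ => 0.

Definition sum2 (a : dir -> R) : R := a iu + a iv.

Definition coord (i : dir) (p : plane) : R :=
  match i with iu => fst p | iv => snd p end.

Definition slice (i : dir) (f : plane -> R) (p : plane) : R -> R :=
  match i with
  | iu => fun t => f (t, snd p)
  | iv => fun t => f (fst p, t)
  end.

Definition ex_partial (i : dir) (f : plane -> R) (p : plane) : Prop :=
  ex_derive (slice i f p) (coord i p).

Definition partial (i : dir) (f : plane -> R) (p : plane) : R :=
  Derive (slice i f p) (coord i p).

Fixpoint Ck (n : nat) (f : plane -> R) : Prop :=
  (forall p : plane, continuous f p) /\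
  match n with
  | O => True
  | S m => (forall (i : dir) (p : plane), ex_partial i f p) /\
           (forall i : dir, Ck m (partial i f))
  end.

Definition smooth (f : plane -> R) : Prop := forall n : nat, Ck n f.

Record riem_metric : Type := RiemMetric {
  coef :> dir -> dir -> plane -> R;
  coef_smooth : forall i j, smooth (coef i j);
  coef_sym : forall i j p, coef i j p = coef j i p;
  coef_posdef : forall (p : plane) (X : vec), (exists i, X i <> 0) ->
    0 < sum2 (fun i => sum2 (fun j => coef i j p * X i * X j))
}.

Definition gdet (g : riem_metric) (p : plane) : R :=
  g iu iu p * g iv iv p - g iu iv p * g iv iu p.

Definition ginv (g : riem_metric) (i j : dir) (p : plane) : R :=
  match i, j with
  | iu, iu => g iv iv p / gdet g p
  | iv, iv => g iu iu p / gdet g p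
  | iu, iv => - g iu iv p / gdet g p
  | iv, iu => - g iv iu p / gdet g p
  end.

Definition gradient (g : riem_metric) (f : plane -> R) (p : plane) : vec :=
  fun i => sum2 (fun j => ginv g i j p * partial j f p).

(* [christoffel g k i j] is Gamma^k_{ij}. *)
Definition christoffel (g : riem_metric) (k i j : dir) (p : plane) : R :=
  / 2 * sum2 (fun l => ginv g k l p *
    (partial i (g j l) p + partial j (g i l) p - partial l (g i j) p)).

(* The component along [l] of R(d_i, d_j) d_k, where
   R(X,Y)Z = nabla_X nabla_Y Z - nabla_Y nabla_X Z - nabla_[X,Y] Z. *)
Definition riemann (g : riem_metric) (l k i j : dir) (p : plane) : R :=
  partial i (christoffel g l j k) p - partial j (christoffel g l i k) p
  + sum2 (fun m => christoffel g m j k p * christoffel g l i m p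
                   - christoffel g m i k p * christoffel g l j m p).

(* <R(d_u, d_v) d_v, d_u> / |d_u /\ d_v|^2 *)
Definition gauss_curvature (g : riem_metric) (p : plane) : R :=
  sum2 (fun l => g iu l p * riemann g l iv iu iv p) / gdet g p.

Definition laplacian (g : riem_metric) (f : plane -> R) (p : plane) : R :=
  sum2 (fun i => sum2 (fun j => ginv g i j p *
    (partial i (partial j f) p
     - sum2 (fun k => christoffel g k i j p * partial k f p)))).

(* (nabla_k S)_{ij} for a covariant 2-tensor S *)
Definition cov_deriv (g : riem_metric) (S : dir -> dir -> plane -> R)
    (k i j : dir) (p : plane) : R :=
  partial k (S i j) p
  - sum2 (fun m => christoffel g m k i p * S m j p)
  - sum2 (fun m => christoffel g m k j p * S i m p).

Definition divergence (g : riem_metric) (S : dir -> dir -> plane -> R)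
    (j : dir) (p : plane) : R :=
  sum2 (fun i => sum2 (fun k => ginv g i k p * cov_deriv g S k i j p)).

(* Only the restriction of a curve to some [a, b] is used below; every C^1
   curve on a closed interval extends to a C^1 curve on R. *)
Definition C1_curve (gam : R -> plane) : Prop :=
  forall (i : dir) (t : R),
    ex_derive (fun s => coord i (gam s)) t /\
    continuous (Derive (fun s => coord i (gam s))) t.

Definition velocity (gam : R -> plane) (t : R) : vec :=
  fun i => Derive (fun s => coord i (gam s)) t.

Definition speed (g : riem_metric) (gam : R -> plane) (t : R) : R :=
  sqrt (sum2 (fun i => sum2 (fun j =>
    g i j (gam t) * velocity gam t i * velocity gam t j))).

(* [piecewise_C1_length g p q L]: some piecewise C^1 curve from [p] to [q],
   i.e. a finite concatenation of C^1 arcs, has [g]-length [L]. *)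
Inductive piecewise_C1_length (g : riem_metric) :
    plane -> plane -> R -> Prop :=
| length_const (p : plane) : piecewise_C1_length g p p 0
| length_arc (gam : R -> plane) (a b : R) (q : plane) (L : R) :
    a <= b -> C1_curve gam -> piecewise_C1_length g (gam b) q L ->
    piecewise_C1_length g (gam a) q (RInt (speed g gam) a b + L).

(* The set of lengths is nonempty and bounded below by 0, so the infimum is
   finite and [real] loses nothing. *)
Definition riem_dist (g : riem_metric) (p q : plane) : R :=
  real (Glb_Rbar (piecewise_C1_length g p q)).

Definition complete_metric (g : riem_metric) : Prop :=
  forall x : nat -> plane,
    (forall eps : R, 0 < eps -> exists N : nat, forall n m : nat,
       (N <= n)%nat -> (N <= m)%nat -> riem_dist g (x n) (x m) < eps) ->
    exists l : plane, is_lim_seq (fun n => riem_dist g (x n) l) 0.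

Definition E3 : Type := (R * R * R)%type.

Definition dot (x y : E3) : R :=
  let '(x1, x2, x3) := x in let '(y1, y2, y3) := y in
  x1 * y1 + x2 * y2 + x3 * y3.

Definition comp1 (phi : plane -> E3) (p : plane) : R := fst (fst (phi p)).
Definition comp2 (phi : plane -> E3) (p : plane) : R := snd (fst (phi p)).
Definition comp3 (phi : plane -> E3) (p : plane) : R := snd (phi p).

(* Componentwise application of an operator on functions.  As the target is
   flat, [componentwise (partial i)] is both d phi (d_i) and the pull-back
   covariant derivative in the direction d_i of a section of phi^{-1} T E3. *)
Definition componentwise (D : (plane -> R) -> plane -> R)
    (phi : plane -> E3) (p : plane) : E3 :=
  (D (comp1 phi) p, D (comp2 phi) p, D (comp3 phi) p).

Definition partial3 (i : dir) : (plane -> E3) -> plane -> E3 :=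
  componentwise (partial i).

Definition smooth3 (phi : plane -> E3) : Prop :=
  smooth (comp1 phi) /\ smooth (comp2 phi) /\ smooth (comp3 phi).

Definition differential (phi : plane -> E3) (p : plane) (X : vec) : E3 :=
  componentwise (fun f q => sum2 (fun i => X i * partial i f q)) phi p.

Definition immersion (phi : plane -> E3) : Prop :=
  smooth3 phi /\
  forall (p : plane) (X : vec),
    differential phi p X = (0, 0, 0) -> forall i, X i = 0.

Definition riemannian_immersion (g : riem_metric) (phi : plane -> E3) : Prop :=
  immersion phi /\
  forall (i j : dir) (p : plane),
    dot (partial3 i phi p) (partial3 j phi p) = g i j p.

(* tau(phi) = trace nabla d phi *)
Definition tension (g : riem_metric) (phi : plane -> E3) : plane -> E3 :=
  componentwise (laplacian g) phi.

(* S_2(X,Y) = (1/2 |tau|^2 + <d phi, nabla tau>) <X,Y>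
              - <d phi(X), nabla_Y tau> - <d phi(Y), nabla_X tau> *)
Definition stress_bienergy (g : riem_metric) (phi : plane -> E3)
    (i j : dir) (p : plane) : R :=
  let tau := tension g phi in
  (/ 2 * dot (tau p) (tau p)
   + sum2 (fun k => sum2 (fun l =>
       ginv g k l p * dot (partial3 k phi p) (partial3 l tau p)))) * g i j p
  - dot (partial3 i phi p) (partial3 j tau p)
  - dot (partial3 j phi p) (partial3 i tau p).

Definition biconservative_immersion (g : riem_metric) (phi : plane -> E3) :
    Prop :=
  riemannian_immersion g phi /\
  forall (j : dir) (p : plane), divergence g (stress_bienergy g phi) j p = 0.

Definition gC_coef (C : R) (i j : dir) (p : plane) : R :=
  match i, j with
  | iu, iu | iv, iv => C * cosh (fst p) ^ 6
  | _, _ => 0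
  end.

Lemma cosh_pos (x : R) : 0 < cosh x.
Proof.
  unfold cosh; pose proof (exp_pos x); pose proof (exp_pos (- x)); lra.
Qed.

Lemma is_derive_cosh (x : R) : is_derive cosh x (sinh x).
Proof. apply is_derive_Reals, derivable_pt_lim_cosh. Qed.

Lemma is_derive_sinh (x : R) : is_derive sinh x (cosh x).
Proof. apply is_derive_Reals, derivable_pt_lim_sinh. Qed.

Lemma Ck_continuous (n : nat) (f : plane -> R) :
  Ck n f -> forall p, continuous f p.
Proof. destruct n; intros H; apply H. Qed.

Lemma Ck_pred (n : nat) : forall f : plane -> R, Ck (S n) f -> Ck n f.
Proof.
  induction n as [|n IH]; intros f [Hc [Hd Hp]]; split; auto.
Qed.

Lemma Ck_const (n : nat) : forall c : R, Ck n (fun _ => c).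
Proof.
  induction n as [|n IH]; intros c; (split; [intros p; apply continuous_const|]).
  - exact I.
  - split.
    + intros [] p; exact (ex_derive_const c _).
    + intros i; replace (partial i (fun _ : plane => c))
        with (fun _ : plane => 0); [apply IH|].
      apply functional_extensionality; intros p; symmetry.
      destruct i; exact (Derive_const c _).
Qed.

Lemma Ck_plus (n : nat) : forall f h : plane -> R,
  Ck n f -> Ck n h -> Ck n (fun p => f p + h p).
Proof.
  induction n as [|n IH]; intros f h Hf Hh;
    (split; [intros p; apply (continuous_plus f h);
             eapply Ck_continuous; eassumption|]).
  - exact I.
  - destruct Hf as [_ [Ef Pf]], Hh as [_ [Eh Ph]]; split.
    + intros i p; specialize (Ef i p); specialize (Eh i p).
      destruct i; exact (ex_derive_plus _ _ _ Ef Eh).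
    + intros i; replace (partial i (fun p => f p + h p))
        with (fun p => partial i f p + partial i h p); [now apply IH|].
      apply functional_extensionality; intros p; symmetry.
      specialize (Ef i p); specialize (Eh i p).
      destruct i; exact (Derive_plus _ _ _ Ef Eh).
Qed.

Lemma Ck_mult (n : nat) : forall f h : plane -> R,
  Ck n f -> Ck n h -> Ck n (fun p => f p * h p).
Proof.
  induction n as [|n IH]; intros f h Hf Hh;
    (split; [intros p; apply (continuous_mult f h);
             eapply Ck_continuous; eassumption|]).
  - exact I.
  - pose proof (Ck_pred _ _ Hf) as Lf; pose proof (Ck_pred _ _ Hh) as Lh.
    destruct Hf as [_ [Ef Pf]], Hh as [_ [Eh Ph]]; split.
    + intros i p; specialize (Ef i p); specialize (Eh i p).
      destruct i; exact (ex_derive_mult _ _ _ Ef Eh).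
    + intros i; replace (partial i (fun p => f p * h p))
        with (fun p => partial i f p * h p + f p * partial i h p);
        [apply Ck_plus; now apply IH|].
      apply functional_extensionality; intros p; symmetry.
      specialize (Ef i p); specialize (Eh i p).
      destruct i, p; exact (Derive_mult _ _ _ Ef Eh).
Qed.

Lemma Ck_pow (n k : nat) (f : plane -> R) :
  Ck n f -> Ck n (fun p => f p ^ k).
Proof.
  intros Hf; induction k as [|k IH].
  - exact (Ck_const n 1).
  - exact (Ck_mult n _ _ Hf IH).
Qed.

Lemma Ck_of_fst (n : nat) (f f' : R -> R) :
  (forall x, is_derive f x (f' x)) ->
  Ck n (fun p => f' (fst p)) -> Ck (S n) (fun p => f (fst p)).
Proof.
  intros Hf Hf'; split; [|split].
  - intros p; apply (continuous_comp fst f); [apply continuous_fst|].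
    apply (ex_derive_continuous f); eexists; apply Hf.
  - intros [] p; [eexists; apply Hf | apply (ex_derive_const (f (fst p)))].
  - intros [].
    + replace (partial iu _) with (fun p : plane => f' (fst p)); [exact Hf'|].
      apply functional_extensionality; intros p; symmetry.
      apply is_derive_unique, Hf.
    + replace (partial iv _) with (fun _ : plane => 0); [apply Ck_const|].
      apply functional_extensionality; intros p; symmetry.
      exact (Derive_const (f (fst p)) (snd p)).
Qed.

Lemma Ck_cosh_sinh (n : nat) :
  Ck n (fun p => cosh (fst p)) /\ Ck n (fun p => sinh (fst p)).
Proof.
  induction n as [|n [IHc IHs]].
  - split; eapply Ck_pred, Ck_of_fst.
    + apply is_derive_cosh.
    + split; [|exact I]. intros p.
      apply (continuous_comp fst sinh); [apply continuous_fst|].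
      apply (ex_derive_continuous sinh); eexists; apply is_derive_sinh.
    + apply is_derive_sinh.
    + split; [|exact I]. intros p.
      apply (continuous_comp fst cosh); [apply continuous_fst|].
      apply (ex_derive_continuous cosh); eexists; apply is_derive_cosh.
  - split; [exact (Ck_of_fst n _ _ is_derive_cosh IHs)
           |exact (Ck_of_fst n _ _ is_derive_sinh IHc)].
Qed.

Lemma gC_smooth (C : R) (i j : dir) : smooth (gC_coef C i j).
Proof.
  intros n.
  assert (H : Ck n (fun p => C * cosh (fst p) ^ 6)).
  { apply (Ck_mult n (fun _ => C)); [apply Ck_const|].
    apply (Ck_pow n 6), Ck_cosh_sinh. }
  destruct i, j; first [exact H | exact (Ck_const n 0)].
Qed.

Lemma gC_sym (C : R) (i j : dir) (p : plane) :
  gC_coef C i j p = gC_coef C j i p.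
Proof. now destruct i, j. Qed.

Lemma gC_posdef (C : R) (hC : 0 < C) (p : plane) (X : vec) :
  (exists i, X i <> 0) ->
  0 < sum2 (fun i => sum2 (fun j => gC_coef C i j p * X i * X j)).
Proof.
  intros [i Hi]; unfold sum2, gC_coef.
  assert (HL : 0 < C * cosh (fst p) ^ 6)
    by (apply Rmult_lt_0_compat; [exact hC | apply pow_lt, cosh_pos]).
  set (L := C * cosh (fst p) ^ 6) in *.
  replace (_ + _) with (L * (Rsqr (X iu) + Rsqr (X iv)))
    by (unfold Rsqr; ring).
  apply Rmult_lt_0_compat; [exact HL|].
  pose proof (Rle_0_sqr (X iu)); pose proof (Rle_0_sqr (X iv)).
  destruct i; pose proof (Rlt_0_sqr _ Hi); lra.
Qed.

Definition gC (C : R) (hC : 0 < C) : riem_metric :=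
  RiemMetric (gC_coef C) (gC_smooth C) (gC_sym C) (gC_posdef C hC).

Definition sigma1 (C u : R) : R := sqrt C / 3 * cosh u ^ 3.
Definition sigma2 (C u : R) : R := sqrt C / 2 * (/ 2 * sinh (2 * u) + u).

Definition XC (C : R) (p : plane) : E3 :=
  let '(u, v) := p in
  (sigma1 C u * cos (3 * v), sigma1 C u * sin (3 * v), sigma2 C u).

Definition Ov (p : plane) : Prop := exists v : R, p = (0, v).

(* Main.v *)
Require Import Defs.
From Stdlib Require Import Reals Lra FunctionalExtensionality.
From Coquelicot Require Import Coquelicot.
Open Scope R_scope.

(** Completeness holds because [gC] dominates the Euclidean metric: since
    [cosh >= 1], g_C(X,X) >= C |X|^2, so [sqrt C] times the variation of either
    coordinate bounds the length of any curve from below.  A Cauchy sequence for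
    the Riemannian distance is therefore Cauchy in each coordinate and converges
    in the plane; conversely the coefficients of the metric are bounded near the
    limit, so straight segments show that coordinate convergence implies
    convergence for the distance ([complete_of_dominates_euclidean]).

    Everything else is a computation in isothermal coordinates, where the
    conformal factor [lam] depends on u only.  With rho = lam' / (2 lam) the only
    nonzero Christoffel symbols are [rho] and [- rho], whence K = - rho' / lam and
    the Laplacian is the flat one divided by [lam].  For [gC],
    rho = 3 tanh u, which gives the curvature and its gradient.

    The map [XC] parametrizes a surface of revolution.  Rotational symmetry splits
    the E3-valued maps that occur into meridian fields, [revolve], and
    fields along the parallels, [spin]; these families are orthogonal to each other
    and their union is stable under the partial derivatives.  So the tension
    field is again of the form [revolve], and the stress-bienergy tensor is
    diagonal with entries depending on u only.  For such a tensor diag(a, b) the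
    divergence vanishes exactly when a' = rho (a + b)
    ([divergence_isothermal]).  Here a = - 6 / cosh^2 and b = 10 / cosh^2
    ([XC_stress]), and both sides equal 12 sinh / cosh^3. *)

(** * Completeness of metrics that dominate a Euclidean one *)

Lemma C1_curve_continuous (gam : R -> plane) (i : dir) (t : R) :
  C1_curve gam -> continuous (fun s => coord i (gam s)) t.
Proof.
  intros H; apply (ex_derive_continuous (fun s => coord i (gam s))), H.
Qed.

Lemma coef_along_curve_continuous (g : riem_metric) (gam : R -> plane)
    (i j : dir) (t : R) :
  C1_curve gam -> continuous (fun s => g i j (gam s)) t.
Proof.
  intros H.
  apply (continuous_ext (fun s => g i j (coord iu (gam s), coord iv (gam s)))).
  { intros s; simpl; destruct (gam s); reflexivity. }
  apply (continuous_comp_2 (fun s => coord iu (gam s)) (fun s => coord iv (gam s))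
    (fun x y => g i j (x, y))).
  - now apply C1_curve_continuous.
  - now apply C1_curve_continuous.
  - apply (continuous_ext (g i j)); [now intros []|].
    apply (Ck_continuous 0), coef_smooth.
Qed.

Lemma speed_continuous (g : riem_metric) (gam : R -> plane) (t : R) :
  C1_curve gam -> continuous (speed g gam) t.
Proof.
  intros H; unfold speed, sum2, velocity.
  apply continuous_comp; [|apply continuous_sqrt].
  assert (K : forall i j, continuous (fun s => g i j (gam s) *
     Derive (fun s => coord i (gam s)) s * Derive (fun s => coord j (gam s)) s) t).
  { intros i j.
    apply (continuous_mult (fun s => g i j (gam s) *
      Derive (fun s => coord i (gam s)) s) (Derive (fun s => coord j (gam s))));
      [|apply H].
    apply (continuous_mult (fun s => g i j (gam s)));
      [now apply coef_along_curve_continuous | apply H]. }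
  repeat first [apply K | apply @continuous_plus].
Qed.

Lemma speed_integrable (g : riem_metric) (gam : R -> plane) (a b : R) :
  C1_curve gam -> ex_RInt (speed g gam) a b.
Proof.
  intros H; apply (ex_RInt_continuous (speed g gam)).
  intros t _; now apply speed_continuous.
Qed.

Definition dominates_euclidean (g : riem_metric) (m : R) : Prop :=
  forall (p : plane) (X : vec),
    m ^ 2 * (X iu ^ 2 + X iv ^ 2) <=
    sum2 (fun i => sum2 (fun j => g i j p * X i * X j)).

(** The m-scaled Euclidean norm of the velocity lies between the two sides. *)
Lemma speed_ge_velocity (g : riem_metric) (m : R) (gam : R -> plane)
    (i : dir) (t : R) :
  0 < m -> dominates_euclidean g m ->
  m * Rabs (velocity gam t i) <= speed g gam t.
Proof.
  intros Hm Hg; unfold speed.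
  rewrite <- (Rabs_pos_eq m), <- Rabs_mult by lra.
  rewrite <- sqrt_Rsqr_abs; apply sqrt_le_1_alt.
  eapply Rle_trans; [|apply Hg].
  rewrite Rsqr_mult, <- !Rsqr_pow2.
  apply Rmult_le_compat_l; [apply Rle_0_sqr|].
  pose proof (Rle_0_sqr (velocity gam t iu)).
  pose proof (Rle_0_sqr (velocity gam t iv)).
  destruct i; lra.
Qed.

(** On an arc, the variation of a coordinate is at most the integral of the
    absolute value of its derivative; the arcs add up by the triangle inequality. *)
Lemma length_ge_coord (g : riem_metric) (m : R) (p q : plane) (L : R) (i : dir) :
  0 < m -> dominates_euclidean g m -> piecewise_C1_length g p q L ->
  m * Rabs (coord i q - coord i p) <= L.
Proof.
  intros Hm Hg HL; induction HL as [p | gam a b q L Hab Hgam HL IH].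
  - rewrite Rminus_diag, Rabs_R0; lra.
  - assert (Harc : m * Rabs (coord i (gam b) - coord i (gam a)) <=
                   RInt (speed g gam) a b).
    { rewrite <- (Rabs_pos_eq m) at 1 by lra; rewrite <- Rabs_mult.
      apply (norm_RInt_le (V := R_NormedModule)
        (fun t => m * velocity gam t i) (speed g gam) a b); trivial.
      - intros t _; change (Rabs (m * velocity gam t i) <= speed g gam t).
        rewrite Rabs_mult, (Rabs_pos_eq m) by lra.
        now apply speed_ge_velocity.
      - apply (is_RInt_scal (V := R_NormedModule) (fun t => velocity gam t i)).
        apply (is_RInt_derive (V := R_CompleteNormedModule)
          (fun t => coord i (gam t)) (fun t => velocity gam t i)).
        + intros t _; apply Derive_correct, Hgam.
        + intros t _; apply Hgam.
      - apply (RInt_correct (V := R_CompleteNormedModule)).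
        now apply speed_integrable. }
    pose proof (Rabs_triang (coord i q - coord i (gam b))
      (coord i (gam b) - coord i (gam a))) as Htri.
    replace (coord i q - coord i (gam b) + (coord i (gam b) - coord i (gam a)))
      with (coord i q - coord i (gam a)) in Htri by ring.
    apply (Rmult_le_compat_l m) in Htri; lra.
Qed.

Definition segment (p q : plane) (t : R) : plane :=
  (fst p + t * (fst q - fst p), snd p + t * (snd q - snd p)).

Lemma is_derive_segment (p q : plane) (i : dir) (t : R) :
  is_derive (fun s => coord i (segment p q s)) t (coord i q - coord i p).
Proof. destruct i; simpl; auto_derive; trivial; ring. Qed.

Lemma velocity_segment (p q : plane) (i : dir) (t : R) :
  velocity (segment p q) t i = coord i q - coord i p.
Proof. apply is_derive_unique, is_derive_segment. Qed.

Lemma segment_C1 (p q : plane) : C1_curve (segment p q).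
Proof.
  intros i t; split.
  - eexists; apply is_derive_segment.
  - apply (continuous_ext (fun _ => coord i q - coord i p)).
    + intros s; symmetry; apply velocity_segment.
    + apply continuous_const.
Qed.

Lemma segment_length (g : riem_metric) (p q : plane) :
  piecewise_C1_length g p q (RInt (speed g (segment p q)) 0 1).
Proof.
  assert (E0 : segment p q 0 = p)
    by (destruct p; unfold segment; simpl; f_equal; ring).
  assert (E1 : segment p q 1 = q)
    by (destruct p, q; unfold segment; simpl; f_equal; ring).
  pose proof (length_arc g (segment p q) 0 1 q 0 Rle_0_1 (segment_C1 p q)) as H.
  rewrite E0, E1, Rplus_0_r in H; apply H, length_const.
Qed.

(** The distance is the [real] part of an infimum in [Rbar], which would be the
    junk value 0 at an infinite infimum.  The lower bound [m] and the segment from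
    [p] to [q] exclude the two infinite cases, so that [riem_dist] has both
    properties of an infimum. *)
Lemma riem_dist_glb (g : riem_metric) (p q : plane) (m : R) :
  (forall L, piecewise_C1_length g p q L -> m <= L) ->
  m <= riem_dist g p q /\
  (forall L, piecewise_C1_length g p q L -> riem_dist g p q <= L).
Proof.
  intros Hm; unfold riem_dist.
  destruct (Glb_Rbar_correct (piecewise_C1_length g p q)) as [Hlb Hglb].
  assert (H1 := Hglb (Finite m) Hm).
  assert (H2 := Hlb _ (segment_length g p q)).
  destruct (Glb_Rbar (piecewise_C1_length g p q)) as [d| |];
    simpl in *; try contradiction.
  split; [exact H1 | exact Hlb].
Qed.

Lemma riem_dist_ge_coord (g : riem_metric) (m : R) (p q : plane) (i : dir) :
  0 < m -> dominates_euclidean g m ->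
  m * Rabs (coord i q - coord i p) <= riem_dist g p q.
Proof.
  intros Hm Hg; apply riem_dist_glb.
  intros L HL; now apply length_ge_coord with g.
Qed.

Lemma riem_dist_le_segment (g : riem_metric) (m : R) (p q : plane) :
  0 < m -> dominates_euclidean g m ->
  riem_dist g p q <= RInt (speed g (segment p q)) 0 1.
Proof.
  intros Hm Hg.
  apply (riem_dist_glb g p q (m * Rabs (coord iu q - coord iu p)));
    [|apply segment_length].
  intros L HL; now apply length_ge_coord with g.
Qed.

Lemma metric_locally_bounded (g : riem_metric) (l : plane) :
  exists (B : R) (r : posreal), 0 < B /\
    forall p : plane, ball l r p -> forall i j, Rabs (g i j p) <= B.
Proof.
  assert (H : forall i j, locally l (fun p : plane => ball (g i j l) 1 (g i j p))).
  { intros i j; apply (Ck_continuous 0 (g i j) (coef_smooth g i j 0%nat) l).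
    apply (locally_ball (g i j l) (mkposreal 1 Rlt_0_1)). }
  assert (H' : locally l (fun p : plane => forall i j, ball (g i j l) 1 (g i j p))).
  { generalize (filter_and _ _ (filter_and _ _ (H iu iu) (H iu iv))
                             (filter_and _ _ (H iv iu) (H iv iv))).
    apply filter_imp; intros p [[? ?] [? ?]] [] []; assumption. }
  destruct H' as [r Hr].
  exists (Rabs (g iu iu l) + Rabs (g iu iv l) + Rabs (g iv iu l)
          + Rabs (g iv iv l) + 1), r.
  pose proof (Rabs_pos (g iu iu l)); pose proof (Rabs_pos (g iu iv l)).
  pose proof (Rabs_pos (g iv iu l)); pose proof (Rabs_pos (g iv iv l)).
  split; [lra|].
  intros p Hp i j; specialize (Hr p Hp i j).
  change (Rabs (g i j p - g i j l) < 1) in Hr.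
  pose proof (Rabs_triang_inv (g i j p) (g i j l)).
  destruct i, j; lra.
Qed.

(** The integrand of the length of the segment is bounded: if all |g_ij| <= B then
    g(X,X) <= B (|X_u| + |X_v|)^2. *)
Lemma riem_dist_le_taxicab (g : riem_metric) (m B : R) (p q : plane) :
  0 < m -> dominates_euclidean g m -> 0 < B ->
  (forall t, 0 <= t <= 1 -> forall i j, Rabs (g i j (segment p q t)) <= B) ->
  riem_dist g p q <=
    sqrt B * (Rabs (coord iu q - coord iu p) + Rabs (coord iv q - coord iv p)).
Proof.
  intros Hm Hg HB Hbound.
  eapply Rle_trans; [now apply (riem_dist_le_segment g m)|].
  set (d := fun i => coord i q - coord i p).
  fold (d iu) (d iv).
  set (D := sqrt B * (Rabs (d iu) + Rabs (d iv))).
  replace D with (RInt (fun _ => D) 0 1)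
    by (rewrite RInt_const; unfold scal; simpl; unfold mult; simpl; ring).
  apply RInt_le; [lra | apply speed_integrable, segment_C1 | apply ex_RInt_const |].
  intros t Ht; unfold speed.
  assert (HD : 0 <= D).
  { apply Rmult_le_pos; [apply sqrt_pos|].
    apply Rplus_le_le_0_compat; apply Rabs_pos. }
  rewrite <- (sqrt_pow2 D HD); apply sqrt_le_1_alt.
  assert (K : forall i j, g i j (segment p q t) * d i * d j <=
                          B * (Rabs (d i) * Rabs (d j))).
  { intros i j; eapply Rle_trans; [apply Rle_abs|].
    rewrite !Rabs_mult, Rmult_assoc.
    apply Rmult_le_compat_r; [apply Rmult_le_pos; apply Rabs_pos|].
    apply Hbound; lra. }
  unfold sum2; rewrite !velocity_segment; fold (d iu) (d iv).
  replace (D ^ 2) with (B * (Rabs (d iu) * Rabs (d iu)) + B * (Rabs (d iu) * Rabs (d iv))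
     + (B * (Rabs (d iv) * Rabs (d iu)) + B * (Rabs (d iv) * Rabs (d iv)))).
  2: { unfold D; rewrite Rpow_mult_distr, pow2_sqrt by lra; ring. }
  repeat apply Rplus_le_compat; apply K.
Qed.

(** Near [l] the coefficients of the metric are bounded, and balls of the plane
    are convex, so the taxicab bound applies to the tail of the sequence. *)
Lemma riem_dist_lim (g : riem_metric) (m : R) (x : nat -> plane) (l : plane) :
  0 < m -> dominates_euclidean g m ->
  (forall i, is_lim_seq (fun n => coord i (x n)) (coord i l)) ->
  is_lim_seq (fun n => riem_dist g (x n) l) 0.
Proof.
  intros Hm Hg Hx.
  destruct (metric_locally_bounded g l) as [B [r [HB Hbound]]].
  assert (Habs : forall i,
    is_lim_seq (fun n => Rabs (coord i l - coord i (x n))) 0).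
  { intros i; rewrite <- Rabs_R0.
    apply (is_lim_seq_abs _ (Finite 0)).
    rewrite <- (Rminus_diag (coord i l)).
    apply (is_lim_seq_minus' (fun _ => coord i l) (fun n => coord i (x n)));
      [apply is_lim_seq_const | apply Hx]. }
  apply is_lim_seq_le_le_loc with (u := fun _ => 0)
    (w := fun n => sqrt B * (Rabs (coord iu l - coord iu (x n))
                             + Rabs (coord iv l - coord iv (x n)))).
  - assert (E : forall i, eventually (fun n => Rabs (coord i l - coord i (x n)) < r)).
    { intros i; pose proof (proj2 (is_lim_seq_spec _ _) (Habs i)) as Hl.
      generalize (Hl r); apply filter_imp; intros n.
      rewrite Rminus_0_r, Rabs_Rabsolu; trivial. }
    generalize (filter_and _ _ (E iu) (E iv)); apply filter_imp.
    intros n [Eu Ev]; split.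
    + eapply Rle_trans; [|now apply (riem_dist_ge_coord g m _ _ iu)].
      apply Rmult_le_pos; [lra | apply Rabs_pos].
    + apply (riem_dist_le_taxicab g m); trivial.
      intros t Ht; apply Hbound.
      assert (Hball : forall a b : R, Rabs (b - a) < r ->
                Rabs (a + t * (b - a) - b) < r).
      { intros a b Hab.
        replace (a + t * (b - a) - b) with ((t - 1) * (b - a)) by ring.
        rewrite Rabs_mult, (Rabs_left1 (t - 1)) by lra.
        eapply Rle_lt_trans; [|exact Hab].
        rewrite <- (Rmult_1_l (Rabs (b - a))) at 2.
        apply Rmult_le_compat_r; [apply Rabs_pos | lra]. }
      split; [exact (Hball _ _ Eu) | exact (Hball _ _ Ev)].
  - apply is_lim_seq_const.
  - replace 0 with (sqrt B * (0 + 0)) by ring.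
    apply (is_lim_seq_scal_l _ (sqrt B) (Finite (0 + 0))).
    apply is_lim_seq_plus'; apply Habs.
Qed.

(** The lower bound on distances makes the coordinates of a Cauchy sequence
    Cauchy in R. *)
Lemma complete_of_dominates_euclidean (g : riem_metric) (m : R) :
  0 < m -> dominates_euclidean g m -> complete_metric g.
Proof.
  intros Hm Hg x Hx.
  assert (Hlim : forall i, ex_finite_lim_seq (fun n => coord i (x n))).
  { intros i; apply ex_lim_seq_cauchy_corr; intros eps.
    destruct (Hx (m * eps)) as [N HN];
      [apply Rmult_lt_0_compat; [exact Hm | apply cond_pos]|].
    exists N; intros n k Hn Hk.
    apply (Rmult_lt_reg_l m); [exact Hm|].
    eapply Rle_lt_trans; [|exact (HN k n Hk Hn)].
    now apply riem_dist_ge_coord. }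
  destruct (Hlim iu) as [a Ha], (Hlim iv) as [b Hb].
  exists (a, b); apply (riem_dist_lim g m); trivial.
  intros []; assumption.
Qed.

(** * Metrics with a conformal factor depending on u only *)

Lemma partial_eq (i : dir) (f f' : plane -> R) :
  (forall p, is_derive (slice i f p) (coord i p) (f' p)) -> partial i f = f'.
Proof.
  intros H; apply functional_extensionality; intros p; apply is_derive_unique, H.
Qed.

Lemma partial_iu_of_fst (f f' : R -> R) :
  (forall x, is_derive f x (f' x)) ->
  partial iu (fun p => f (fst p)) = (fun p => f' (fst p)).
Proof. intros H; apply partial_eq; intros p; apply H. Qed.

Lemma partial_iv_of_fst (f : R -> R) :
  partial iv (fun p => f (fst p)) = (fun _ => 0).
Proof. apply partial_eq; intros p; apply (is_derive_const (f (fst p))). Qed.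

Lemma partial_const (i : dir) (c : R) : partial i (fun _ => c) = (fun _ => 0).
Proof. apply partial_eq; intros p; destruct i; apply (is_derive_const c). Qed.

(** Here [rho] is half the logarithmic derivative of the conformal factor [lam];
    for the metric e^(2w) (du^2 + dv^2) it is w'. *)
Record isothermal_fst (g : riem_metric) (lam rho : R -> R) : Prop := {
  iso_pos : forall x, 0 < lam x;
  iso_derive : forall x, is_derive lam x (2 * rho x * lam x);
  iso_uu : g iu iu = (fun p => lam (fst p));
  iso_vv : g iv iv = (fun p => lam (fst p));
  iso_uv : g iu iv = (fun _ => 0);
  iso_vu : g iv iu = (fun _ => 0)
}.

Lemma ginv_isothermal (g : riem_metric) (lam rho : R -> R)
    (Hg : isothermal_fst g lam rho)
    (i j : dir) (p : plane) :
  ginv g i j p = match i, j with iu, iu | iv, iv => / lam (fst p) | _, _ => 0 end.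
Proof.
  pose proof (iso_pos g lam rho Hg (fst p)).
  destruct i, j; unfold ginv, gdet;
    rewrite (iso_uu g lam rho Hg), (iso_vv g lam rho Hg),
            (iso_uv g lam rho Hg), (iso_vu g lam rho Hg); field; lra.
Qed.

Lemma christoffel_isothermal (g : riem_metric) (lam rho : R -> R)
    (Hg : isothermal_fst g lam rho)
    (k i j : dir) :
  christoffel g k i j =
  (fun p => match k, i, j with
     | iu, iu, iu | iv, iu, iv | iv, iv, iu => rho (fst p)
     | iu, iv, iv => - rho (fst p)
     | _, _, _ => 0
     end).
Proof.
  apply functional_extensionality; intros p.
  pose proof (iso_pos g lam rho Hg (fst p)).
  destruct k, i, j; unfold christoffel, sum2; rewrite !(ginv_isothermal g lam rho Hg);
    rewrite ?(iso_uu g lam rho Hg), ?(iso_vv g lam rho Hg),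
            ?(iso_uv g lam rho Hg), ?(iso_vu g lam rho Hg);
    rewrite ?(partial_iu_of_fst lam _ (iso_derive g lam rho Hg)),
            ?partial_iv_of_fst, ?partial_const; field; lra.
Qed.

(** The Liouville formula K = - (log lam)'' / (2 lam). *)
Lemma gauss_curvature_isothermal (g : riem_metric) (lam rho : R -> R)
    (Hg : isothermal_fst g lam rho)
    (rho' : R -> R) :
  (forall x, is_derive rho x (rho' x)) ->
  gauss_curvature g = (fun p => - rho' (fst p) / lam (fst p)).
Proof.
  intros Hrho; apply functional_extensionality; intros p.
  pose proof (iso_pos g lam rho Hg (fst p)).
  unfold gauss_curvature, gdet, riemann, sum2.
  rewrite (iso_uu g lam rho Hg), (iso_vv g lam rho Hg),
          (iso_uv g lam rho Hg), (iso_vu g lam rho Hg).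
  rewrite !(christoffel_isothermal g lam rho Hg).
  rewrite (partial_iu_of_fst (fun x => - rho x) (fun x => - rho' x)),
    (partial_iv_of_fst rho), !partial_const.
  2: { intros x; apply (is_derive_opp rho), Hrho. }
  field; lra.
Qed.

(** In dimension two the trace g^ij Gamma^k_ij vanishes in isothermal
    coordinates, which leaves only the second-order terms. *)
Lemma laplacian_isothermal (g : riem_metric) (lam rho : R -> R)
    (Hg : isothermal_fst g lam rho)
    (f : plane -> R) (p : plane) :
  laplacian g f p =
  (partial iu (partial iu f) p + partial iv (partial iv f) p) / lam (fst p).
Proof.
  pose proof (iso_pos g lam rho Hg (fst p)).
  unfold laplacian, sum2; rewrite !(ginv_isothermal g lam rho Hg),
      !(christoffel_isothermal g lam rho Hg).
  field; lra.
Qed.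

(** The u-component collects a' - 2 rho a from the derivative along u, and
    rho a - rho b from the Christoffel symbols in the derivative along v. *)
Lemma divergence_isothermal (g : riem_metric) (lam rho : R -> R)
    (Hg : isothermal_fst g lam rho)
    (S : dir -> dir -> plane -> R) (a a' b : R -> R) :
  (forall x, is_derive a x (a' x)) ->
  S iu iu = (fun p => a (fst p)) -> S iv iv = (fun p => b (fst p)) ->
  S iu iv = (fun _ => 0) -> S iv iu = (fun _ => 0) ->
  forall (j : dir) (p : plane),
    divergence g S j p =
    match j with
    | iu => (a' (fst p) - rho (fst p) * (a (fst p) + b (fst p))) / lam (fst p)
    | iv => 0
    end.
Proof.
  intros Ha Suu Svv Suv Svu j p.
  pose proof (iso_pos g lam rho Hg (fst p)).
  destruct j; unfold divergence, cov_deriv, sum2;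
    rewrite !(ginv_isothermal g lam rho Hg),
      !(christoffel_isothermal g lam rho Hg), Suu, Svv, Suv, Svu;
    rewrite ?(partial_iu_of_fst a _ Ha), ?partial_iv_of_fst, ?partial_const;
    field; lra.
Qed.

Lemma gradient_isothermal (g : riem_metric) (lam rho : R -> R)
    (Hg : isothermal_fst g lam rho)
    (f : plane -> R) (i : dir) (p : plane) :
  gradient g f p i = partial i f p / lam (fst p).
Proof.
  pose proof (iso_pos g lam rho Hg (fst p)).
  destruct i; unfold gradient, sum2; rewrite !(ginv_isothermal g lam rho Hg); field; lra.
Qed.

Lemma tension_isothermal (g : riem_metric) (lam rho : R -> R)
    (phi : plane -> E3) (p : plane) :
  isothermal_fst g lam rho ->
  let lap comp := (comp (partial3 iu (partial3 iu phi)) p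
                   + comp (partial3 iv (partial3 iv phi)) p) / lam (fst p) in
  tension g phi p = (lap comp1, lap comp2, lap comp3).
Proof.
  intros Hg; unfold tension, componentwise.
  now rewrite !(laplacian_isothermal g lam rho).
Qed.

(** * Surfaces of revolution *)

(** Besides surfaces of revolution, swept at angular speed [k], this describes the
    vector fields along them that lie in the meridian plane and are invariant
    under rotation. *)
Definition revolve (k : R) (F G : R -> R) (p : plane) : E3 :=
  (F (fst p) * cos (k * snd p), F (fst p) * sin (k * snd p), G (fst p)).

(** The rotation-invariant vector fields tangent to the parallels. *)
Definition spin (k : R) (H : R -> R) (p : plane) : E3 :=
  (- H (fst p) * sin (k * snd p), H (fst p) * cos (k * snd p), 0).

Lemma componentwise_partial_eq (i : dir) (phi psi : plane -> E3) :
  (forall p, is_derive (slice i (comp1 phi) p) (coord i p) (comp1 psi p)) ->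
  (forall p, is_derive (slice i (comp2 phi) p) (coord i p) (comp2 psi p)) ->
  (forall p, is_derive (slice i (comp3 phi) p) (coord i p) (comp3 psi p)) ->
  partial3 i phi = psi.
Proof.
  intros H1 H2 H3; apply functional_extensionality; intros p.
  unfold partial3, componentwise.
  rewrite (partial_eq _ _ _ H1), (partial_eq _ _ _ H2), (partial_eq _ _ _ H3).
  unfold comp1, comp2, comp3; now destruct (psi p) as [[? ?] ?].
Qed.

Lemma partial3_iu_revolve (k : R) (F F' G G' : R -> R) :
  (forall x, is_derive F x (F' x)) -> (forall x, is_derive G x (G' x)) ->
  partial3 iu (revolve k F G) = revolve k F' G'.
Proof.
  intros HF HG; apply componentwise_partial_eq; intros p; simpl;
    unfold comp1, comp2, comp3; simpl.
  - apply (is_derive_scal_l (K := R_AbsRing) (V := R_NormedModule) F), HF.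
  - apply (is_derive_scal_l (K := R_AbsRing) (V := R_NormedModule) F), HF.
  - apply HG.
Qed.

Lemma partial3_iv_revolve (k : R) (F G : R -> R) :
  partial3 iv (revolve k F G) = spin k (fun x => k * F x).
Proof.
  apply componentwise_partial_eq; intros p; simpl;
    unfold comp1, comp2, comp3; simpl; auto_derive; trivial; ring.
Qed.

Lemma partial3_iv_spin (k : R) (H : R -> R) :
  partial3 iv (spin k H) = revolve k (fun x => - k * H x) (fun _ => 0).
Proof.
  apply componentwise_partial_eq; intros p; simpl;
    unfold comp1, comp2, comp3; simpl; auto_derive; trivial; ring.
Qed.

Lemma cos_sin_sqr (x : R) : cos x ^ 2 + sin x ^ 2 = 1.
Proof. pose proof (sin2_cos2 x) as H; rewrite !Rsqr_pow2 in H; lra. Qed.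

Lemma dot_revolve_revolve (k : R) (F1 G1 F2 G2 : R -> R) (p : plane) :
  dot (revolve k F1 G1 p) (revolve k F2 G2 p)
  = F1 (fst p) * F2 (fst p) + G1 (fst p) * G2 (fst p).
Proof.
  unfold dot, revolve.
  rewrite <- (Rmult_1_r (F1 (fst p) * F2 (fst p))), <- (cos_sin_sqr (k * snd p)).
  ring.
Qed.

Lemma dot_spin_spin (k : R) (H1 H2 : R -> R) (p : plane) :
  dot (spin k H1 p) (spin k H2 p) = H1 (fst p) * H2 (fst p).
Proof.
  unfold dot, spin.
  rewrite <- (Rmult_1_r (H1 (fst p) * H2 (fst p))), <- (cos_sin_sqr (k * snd p)).
  ring.
Qed.

Lemma dot_revolve_spin (k : R) (F G H : R -> R) (p : plane) :
  dot (revolve k F G p) (spin k H p) = 0.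
Proof. unfold dot, revolve, spin; ring. Qed.

Lemma dot_spin_revolve (k : R) (F G H : R -> R) (p : plane) :
  dot (spin k H p) (revolve k F G p) = 0.
Proof. unfold dot, revolve, spin; ring. Qed.

(** Differentiating twice along v multiplies the radial part by - k^2 and kills
    the axial part. *)
Lemma tension_revolve (g : riem_metric) (lam rho : R -> R)
    (k : R) (F F' F'' G G' G'' : R -> R) :
  isothermal_fst g lam rho ->
  (forall x, is_derive F x (F' x)) -> (forall x, is_derive F' x (F'' x)) ->
  (forall x, is_derive G x (G' x)) -> (forall x, is_derive G' x (G'' x)) ->
  tension g (revolve k F G) =
  revolve k (fun x => (F'' x - k ^ 2 * F x) / lam x) (fun x => G'' x / lam x).
Proof.
  intros Hg HF HF' HG HG'; apply functional_extensionality; intros p.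
  rewrite (tension_isothermal g lam rho); trivial.
  rewrite (partial3_iu_revolve k F F' G G'), (partial3_iu_revolve k F' F'' G' G''),
    partial3_iv_revolve, partial3_iv_spin; trivial.
  pose proof (iso_pos g lam rho Hg (fst p)).
  unfold comp1, comp2, comp3, revolve; cbn [fst snd].
  f_equal; [f_equal|]; field; lra.
Qed.

(** [r] and [a] are the values of <d phi, nabla tau> on (d_u, d_u) and
    (d_v, d_v).  Their sum, the trace term of the tensor, enters both diagonal
    entries, from which 2 r and 2 a respectively are subtracted.
    The mixed entries pair meridian fields with fields along the parallels,
    which are orthogonal. *)
Lemma stress_bienergy_revolve (g : riem_metric) (lam rho : R -> R)
    (k : R) (F F' G G' T T' W W' : R -> R) :
  isothermal_fst g lam rho ->
  (forall x, is_derive F x (F' x)) -> (forall x, is_derive G x (G' x)) ->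
  (forall x, is_derive T x (T' x)) -> (forall x, is_derive W x (W' x)) ->
  tension g (revolve k F G) = revolve k T W ->
  forall (i j : dir),
  stress_bienergy g (revolve k F G) i j =
  (fun p => let x := fst p in
     let e := / 2 * (T x ^ 2 + W x ^ 2) * lam x in
     let r := F' x * T' x + G' x * W' x in
     let a := k ^ 2 * (F x * T x) in
     match i, j with
     | iu, iu => e + a - r
     | iv, iv => e + r - a
     | _, _ => 0
     end).
Proof.
  intros Hg HF HG HT HW Htau i j; apply functional_extensionality; intros p.
  pose proof (iso_pos g lam rho Hg (fst p)).
  unfold stress_bienergy, sum2; rewrite Htau.
  rewrite !(ginv_isothermal g lam rho Hg).
  destruct i, j;
    rewrite (partial3_iu_revolve k F F' G G'), (partial3_iu_revolve k T T' W W'),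
      !partial3_iv_revolve; trivial;
    rewrite !dot_revolve_revolve, !dot_revolve_spin, ?dot_spin_revolve,
      !dot_spin_spin;
    rewrite ?(iso_uu g lam rho Hg), ?(iso_vv g lam rho Hg),
            ?(iso_uv g lam rho Hg), ?(iso_vu g lam rho Hg); cbv zeta; field; lra.
Qed.

(** * Isometric maps and smoothness *)

(** |d phi(X)|^2 = g(X,X), and [g] is positive definite. *)
Lemma isometric_injective (g : riem_metric) (phi : plane -> E3) :
  (forall i j p, dot (partial3 i phi p) (partial3 j phi p) = g i j p) ->
  forall (p : plane) (X : vec), Defs.differential phi p X = (0, 0, 0) ->
  forall i, X i = 0.
Proof.
  intros Hiso p X HX i.
  destruct (Req_dec (X i) 0) as [|Hi]; [assumption | exfalso].
  apply (Rlt_irrefl 0).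
  apply Rlt_le_trans with (1 := coef_posdef g p X (ex_intro _ i Hi)).
  replace 0 with (dot (Defs.differential phi p X) (Defs.differential phi p X))
    by (rewrite HX; simpl; ring).
  unfold sum2; rewrite <- !Hiso; apply Req_le.
  unfold Defs.differential, partial3, componentwise, sum2, dot; ring.
Qed.

Lemma Ck0_of_snd (f : R -> R) :
  (forall x, ex_derive f x) -> Ck 0 (fun p => f (snd p)).
Proof.
  intros Hf; split; [intros p | exact I].
  apply (continuous_comp snd f); [apply continuous_snd|].
  apply (ex_derive_continuous f), Hf.
Qed.

Lemma Ck_of_snd (n : nat) (f f' : R -> R) :
  (forall x, is_derive f x (f' x)) ->
  Ck n (fun p => f' (snd p)) -> Ck (S n) (fun p => f (snd p)).
Proof.
  intros Hf Hf'; split; [|split].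
  - apply Ck0_of_snd; intros x; eexists; apply Hf.
  - intros [] p; [apply (ex_derive_const (f (snd p))) | eexists; apply Hf].
  - intros [].
    + replace (partial iu _) with (fun _ : plane => 0); [apply Ck_const|].
      symmetry; apply partial_eq; intros p; apply (is_derive_const (f (snd p))).
    + replace (partial iv _) with (fun p : plane => f' (snd p)); [exact Hf'|].
      symmetry; apply partial_eq; intros p; apply Hf.
Qed.

(** The two claims are proved together because the derivative of each function is
    a multiple of the other. *)
Lemma Ck_cos_sin (k : R) (n : nat) :
  Ck n (fun p => cos (k * snd p)) /\ Ck n (fun p => sin (k * snd p)).
Proof.
  induction n as [|n [IHc IHs]].
  - split; [apply (Ck0_of_snd (fun v => cos (k * v)))
           |apply (Ck0_of_snd (fun v => sin (k * v)))];
      intros x; auto_derive; trivial.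
  - split.
    + apply (Ck_of_snd n (fun v => cos (k * v)) (fun v => - k * sin (k * v))).
      * intros x; auto_derive; trivial; ring.
      * apply (Ck_mult n (fun _ => - k)); [apply Ck_const | exact IHs].
    + apply (Ck_of_snd n (fun v => sin (k * v)) (fun v => k * cos (k * v))).
      * intros x; auto_derive; trivial; ring.
      * apply (Ck_mult n (fun _ => k)); [apply Ck_const | exact IHc].
Qed.

Lemma revolve_smooth (k : R) (F G : R -> R) :
  smooth (fun p => F (fst p)) -> smooth (fun p => G (fst p)) ->
  smooth3 (revolve k F G).
Proof.
  intros HF HG; split; [|split].
  - intros n; apply (Ck_mult n _ _ (HF n)), Ck_cos_sin.
  - intros n; apply (Ck_mult n _ _ (HF n)), Ck_cos_sin.
  - exact HG.
Qed.

(** * The metric of the theorem *)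

Lemma sinh_sqr (x : R) : sinh x ^ 2 = cosh x ^ 2 - 1.
Proof.
  unfold sinh, cosh.
  assert (H : exp x * exp (- x) = 1) by (rewrite <- exp_plus, Rplus_opp_r; apply exp_0).
  rewrite <- H; field.
Qed.

Lemma sinh_double (x : R) : sinh (2 * x) = 2 * (sinh x * cosh x).
Proof.
  unfold sinh, cosh.
  replace (2 * x) with (x + x) by ring.
  rewrite Ropp_plus_distr, !exp_plus; field.
Qed.

Definition lamC (C u : R) : R := C * cosh u ^ 6.
Definition rhoC (u : R) : R := 3 * (sinh u / cosh u).

Lemma is_derive_rhoC (x : R) : is_derive rhoC x (3 / cosh x ^ 2).
Proof.
  pose proof (cosh_pos x); unfold rhoC; auto_derive; [lra|].
  field_simplify; [|lra|lra]. rewrite sinh_sqr; field; lra.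
Qed.

Lemma gC_isothermal (C : R) (hC : 0 < C) :
  isothermal_fst (gC C hC) (lamC C) rhoC.
Proof.
  split; trivial.
  - intros x; apply Rmult_lt_0_compat; [exact hC | apply pow_lt, cosh_pos].
  - intros x; pose proof (cosh_pos x); unfold lamC, rhoC.
    auto_derive; trivial; simpl; field; lra.
Qed.

Lemma cosh_ge_1 (x : R) : 1 <= cosh x.
Proof.
  pose proof (sinh_sqr x); pose proof (cosh_pos x); pose proof (pow2_ge_0 (sinh x)).
  nra.
Qed.

Lemma gC_dominates_euclidean (C : R) (hC : 0 < C) :
  dominates_euclidean (gC C hC) (sqrt C).
Proof.
  intros p X; rewrite pow2_sqrt by lra.
  change (C * (X iu ^ 2 + X iv ^ 2) <=
    C * cosh (fst p) ^ 6 * X iu * X iu + 0 * X iu * X iv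
    + (0 * X iv * X iu + C * cosh (fst p) ^ 6 * X iv * X iv)).
  pose proof (pow_R1_Rle (cosh (fst p)) 6 (cosh_ge_1 _)).
  assert (0 <= C * (X iu ^ 2 + X iv ^ 2))
    by (apply Rmult_le_pos; [lra | nra]).
  nra.
Qed.

Lemma gC_curvature (C : R) (hC : 0 < C) :
  gauss_curvature (gC C hC) = (fun p => - (3 / (C * cosh (fst p) ^ 8))).
Proof.
  rewrite (gauss_curvature_isothermal _ _ _ (gC_isothermal C hC) _ is_derive_rhoC).
  apply functional_extensionality; intros p; pose proof (cosh_pos (fst p)).
  unfold lamC; field; lra.
Qed.

Lemma is_derive_curvature (C : R) (hC : 0 < C) (x : R) :
  is_derive (fun u => - (3 / (C * cosh u ^ 8))) x
    (24 / C * (sinh x / cosh x ^ 9)).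
Proof.
  pose proof (cosh_pos x).
  assert (0 < C * cosh x ^ 8) by (apply Rmult_lt_0_compat; [|apply pow_lt]; lra).
  auto_derive; [lra|]. simpl; field; lra.
Qed.

(** * The immersion of the theorem *)

Lemma XC_revolve (C : R) : XC C = revolve 3 (sigma1 C) (sigma2 C).
Proof. apply functional_extensionality; now intros []. Qed.

Definition d_sigma1 (C u : R) : R := sqrt C * (cosh u ^ 2 * sinh u).
Definition d_sigma2 (C u : R) : R := sqrt C * cosh u ^ 2.
(** Radial and axial parts of the tension field of [XC]. *)
Definition tauF (C u : R) : R := - 2 / (sqrt C * cosh u ^ 5).
Definition tauG (C u : R) : R := 2 * sinh u / (sqrt C * cosh u ^ 5).

Lemma is_derive_sigma1 (C x : R) : is_derive (sigma1 C) x (d_sigma1 C x).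
Proof. unfold sigma1, d_sigma1; auto_derive; trivial; simpl; field. Qed.

Lemma is_derive_sigma2 (C x : R) : is_derive (sigma2 C) x (d_sigma2 C x).
Proof.
  apply is_derive_ext with (f := fun u => sqrt C / 2 * (sinh u * cosh u + u)).
  - intros u; change (sqrt C / 2 * (sinh u * cosh u + u) = sigma2 C u).
    unfold sigma2; rewrite sinh_double; field.
  - unfold d_sigma2; auto_derive; trivial.
    replace (cosh x ^ 2) with (/ 2 * (cosh x ^ 2 + sinh x ^ 2 + 1))
      by (rewrite sinh_sqr; field).
    field.
Qed.

(** [sigma2] contains a linear term and sinh (2u); its derivative [d_sigma2] is a
    multiple of cosh^2, whose smoothness is known, so one derivative is given up
    and regained. *)
Lemma XC_smooth (C : R) : smooth3 (XC C).
Proof.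
  assert (H1 : smooth (fun p => sigma1 C (fst p))).
  { intros n; apply (Ck_mult n (fun _ => sqrt C / 3)); [apply Ck_const|].
    apply (Ck_pow n 3), Ck_cosh_sinh. }
  assert (H2 : smooth (fun p => sigma2 C (fst p))).
  { intros n; apply Ck_pred, (Ck_of_fst n _ _ (is_derive_sigma2 C)).
    apply (Ck_mult n (fun _ => sqrt C)); [apply Ck_const|].
    apply (Ck_pow n 2), Ck_cosh_sinh. }
  rewrite XC_revolve; now apply revolve_smooth.
Qed.

(** The meridian part is cosh^4 (sinh^2 + 1) = cosh^6; the factor 1/3 in
    [sigma1] compensates the angular speed 3. *)
Lemma XC_isometric (C : R) (hC : 0 < C) (i j : dir) (p : plane) :
  dot (partial3 i (XC C) p) (partial3 j (XC C) p) = gC C hC i j p.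
Proof.
  pose proof (pow2_sqrt C (Rlt_le _ _ hC)) as HC.
  pose proof (iso_uu _ _ _ (gC_isothermal C hC)) as Huu.
  rewrite XC_revolve.
  destruct i, j;
    rewrite ?(partial3_iu_revolve 3 _ _ _ _ (is_derive_sigma1 C) (is_derive_sigma2 C)),
      ?partial3_iv_revolve, ?dot_revolve_revolve, ?dot_spin_spin,
      ?dot_revolve_spin, ?dot_spin_revolve; trivial;
    change (gC C hC iu iu p) with (C * cosh (fst p) ^ 6);
    change (gC C hC iv iv p) with (C * cosh (fst p) ^ 6);
    unfold d_sigma1, d_sigma2, sigma1;
    set (c := sqrt C) in *; clearbody c; rewrite <- HC.
  - replace (_ + _) with (c ^ 2 * cosh (fst p) ^ 4 * (sinh (fst p) ^ 2 + 1)) by ring.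
    rewrite sinh_sqr; ring.
  - field.
Qed.

Lemma XC_tension (C : R) (hC : 0 < C) :
  tension (gC C hC) (XC C) = revolve 3 (tauF C) (tauG C).
Proof.
  rewrite XC_revolve.
  rewrite (tension_revolve _ _ _ 3 (sigma1 C) (d_sigma1 C)
    (fun u => sqrt C * (2 * cosh u * sinh u ^ 2 + cosh u ^ 3))
    (sigma2 C) (d_sigma2 C) (fun u => sqrt C * (2 * cosh u * sinh u))
    (gC_isothermal C hC)).
  - assert (Hs : 0 < sqrt C) by now apply sqrt_lt_R0.
    pose proof (pow2_sqrt C (Rlt_le _ _ hC)) as HC.
    f_equal; apply functional_extensionality; intros x; pose proof (cosh_pos x);
      unfold tauF, tauG, lamC, sigma1; rewrite ?sinh_sqr;
      set (c := sqrt C) in *; clearbody c; rewrite <- HC; field; lra.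
  - apply is_derive_sigma1.
  - intros x; unfold d_sigma1; auto_derive; trivial; simpl; ring.
  - apply is_derive_sigma2.
  - intros x; unfold d_sigma2; auto_derive; trivial; simpl; ring.
Qed.

Lemma XC_stress (C : R) (hC : 0 < C) (i j : dir) :
  stress_bienergy (gC C hC) (XC C) i j =
  (fun p => match i, j with
     | iu, iu => - 6 / cosh (fst p) ^ 2
     | iv, iv => 10 / cosh (fst p) ^ 2
     | _, _ => 0
     end).
Proof.
  assert (Hs : 0 < sqrt C) by now apply sqrt_lt_R0.
  pose proof (pow2_sqrt C (Rlt_le _ _ hC)) as HC.
  pose proof (XC_tension C hC) as Htau; rewrite XC_revolve in *.
  rewrite (stress_bienergy_revolve _ _ _ 3 (sigma1 C) (d_sigma1 C)
    (sigma2 C) (d_sigma2 C)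
    (tauF C) (fun u => 10 * sinh u / (sqrt C * cosh u ^ 6))
    (tauG C) (fun u => (10 - 8 * cosh u ^ 2) / (sqrt C * cosh u ^ 6))
    (gC_isothermal C hC)); trivial.
  - apply functional_extensionality; intros p; cbv zeta.
    set (x := fst p); pose proof (cosh_pos x) as Hx.
    assert (Hnorm : (tauF C x ^ 2 + tauG C x ^ 2) * lamC C x = 4 / cosh x ^ 2).
    { unfold tauF, tauG, lamC.
      set (c := sqrt C) in *; clearbody c; rewrite <- HC.
      replace ((2 * sinh x / (c * cosh x ^ 5)) ^ 2)
        with (4 * (sinh x ^ 2) / (c * cosh x ^ 5) ^ 2) by (field; lra).
      rewrite sinh_sqr; field; lra. }
    assert (Hradial : d_sigma1 C x * (10 * sinh x / (sqrt C * cosh x ^ 6)) +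
        d_sigma2 C x * ((10 - 8 * cosh x ^ 2) / (sqrt C * cosh x ^ 6)) =
        2 / cosh x ^ 2).
    { unfold d_sigma1, d_sigma2.
      replace (_ + _) with ((10 * sinh x ^ 2 + 10 - 8 * cosh x ^ 2) / cosh x ^ 4)
        by (field; lra).
      rewrite sinh_sqr; field; lra. }
    assert (Hangular : 3 ^ 2 * (sigma1 C x * tauF C x) = - 6 / cosh x ^ 2)
      by (unfold sigma1, tauF; field; lra).
    rewrite Rmult_assoc, Hnorm, Hradial, Hangular.
    destruct i, j; field; lra.
  - apply is_derive_sigma1.
  - apply is_derive_sigma2.
  - intros x; pose proof (cosh_pos x).
    assert (0 < sqrt C * cosh x ^ 5) by (apply Rmult_lt_0_compat; [|apply pow_lt]; lra).
    unfold tauF; auto_derive; [lra|]; simpl; field; lra.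
  - intros x; pose proof (cosh_pos x).
    assert (0 < sqrt C * cosh x ^ 5) by (apply Rmult_lt_0_compat; [|apply pow_lt]; lra).
    unfold tauG; auto_derive; [lra|].
    replace (10 - 8 * cosh x ^ 2) with (2 * cosh x ^ 2 - 10 * sinh x ^ 2)
      by (rewrite sinh_sqr; ring).
    simpl; field; lra.
Qed.

Lemma XC_biconservative (C : R) (hC : 0 < C) :
  biconservative_immersion (gC C hC) (XC C).
Proof.
  split; [split; [split|]|].
  - apply XC_smooth.
  - apply (isometric_injective (gC C hC)), XC_isometric.
  - apply XC_isometric.
  - intros j p.
    assert (Ha : forall x, is_derive (fun u => - 6 / cosh u ^ 2) x
                   (12 * sinh x / cosh x ^ 3)).
    { intros x; pose proof (cosh_pos x).
      assert (0 < cosh x ^ 2) by (apply pow_lt; lra).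
      auto_derive; [lra|]; simpl; field; lra. }
    (* a' = rho (a + b) reads 12 sinh / cosh^3 = 3 tanh * 4 / cosh^2. *)
    rewrite (divergence_isothermal _ _ _ (gC_isothermal C hC) _
      (fun u => - 6 / cosh u ^ 2) _ (fun u => 10 / cosh u ^ 2) Ha);
      try apply XC_stress.
    destruct j; [|reflexivity].
    pose proof (cosh_pos (fst p)); unfold rhoC, lamC; field; lra.
Qed.

Theorem theorem4p1 (C : R) (hC : 0 < C) :
  complete_metric (gC C hC) /\
  ((forall u v : R,
      gauss_curvature (gC C hC) (u, v) = - (3 / (C * cosh u ^ 8)) /\
      - (3 / (C * cosh u ^ 8)) < 0 /\
      is_derive (fun t : R => gauss_curvature (gC C hC) (t, v)) u
        (24 / C * (sinh u / cosh u ^ 9))) /\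
   (forall p : plane, ~ Ov p ->
      gradient (gC C hC) (gauss_curvature (gC C hC)) p <> vec0)) /\
  biconservative_immersion (gC C hC) (XC C).
Proof.
  split; [|split; [split|]].
  - apply (complete_of_dominates_euclidean _ (sqrt C)).
    + now apply sqrt_lt_R0.
    + apply gC_dominates_euclidean.
  - intros u v; rewrite gC_curvature; split; [reflexivity | split].
    + apply Ropp_lt_gt_0_contravar, Rdiv_lt_0_compat; [lra|].
      apply Rmult_lt_0_compat; [exact hC | apply pow_lt, cosh_pos].
    + now apply is_derive_curvature.
  - intros p Hp Hgrad; apply Hp; exists (snd p).
    rewrite (surjective_pairing p) at 1; f_equal.
    (* The u-component of the gradient is a nonzero multiple of sinh u. *)
    apply (f_equal (fun X => X iu)) in Hgrad.
    rewrite (gradient_isothermal _ _ _ (gC_isothermal C hC)), gC_curvature,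
      (partial_iu_of_fst _ _ (is_derive_curvature C hC)) in Hgrad.
    pose proof (iso_pos _ _ _ (gC_isothermal C hC) (fst p)) as Hlam.
    pose proof (cosh_pos (fst p)) as Hch.
    assert (Hs : sinh (fst p) = 0).
    { replace (sinh (fst p)) with
        (24 / C * (sinh (fst p) / cosh (fst p) ^ 9) / lamC C (fst p)
         * (lamC C (fst p) * C * cosh (fst p) ^ 9 / 24)) by (field; lra).
      rewrite Hgrad; unfold vec0; ring. }
    rewrite <- (arcsinh_sinh (fst p)), <- (arcsinh_sinh 0), Hs, sinh_0.
    reflexivity.
  - apply XC_biconservative.
Qed.
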